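(* Let $n>1$ and let $f:SO(n)\to\mathbb{R}$ be the function $f(X)=X_{nn}$ (the lower right entry of $X$). Then $f$ is Morse-Bott, and its critical locus is the disjoint union $F_0\coprod F_{n-1}$, where $$F_0=\{X\in SO(n):X_{nn}=-1\},\qquad F_{n-1}=\{X\in SO(n):X_{nn}=1\},$$ each of which is diffeomorphic to $SO(n-1)$. The Hessian of $f$ has index $0$ at the points of $F_0$ and index $n-1$ at the points of $F_{n-1}$.
   Context: A smooth function is Morse-Bott if its critical locus is a disjoint union of smooth submanifolds and at each critical point the kernel of the Hessian equals the tangent space of the critical locus. The index of the Hessian at a critical point is the maximal dimension of a subspace on which it is negative definite. *)

(* Defs.v *)
From HB Require Import structures.
From mathcomp Require Import all_boot all_order all_algebra.
From mathcomp Require Import all_classical all_reals all_analysis.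

Set Implicit Arguments.
Unset Strict Implicit.
Unset Printing Implicit Defensive.

Import Order.TTheory GRing.Theory Num.Theory.
Import numFieldNormedType.Exports.

Local Open Scope classical_set_scope.
Local Open Scope ring_scope.

(** Smooth manifolds are taken as embedded submanifolds of a Euclidean space
    (here a space of matrices), and smoothness of maps between subsets of
    Euclidean spaces is in the sense of Milnor and Guillemin-Pollack.  A map
    defined on a subset is represented by a total function; only its values on
    the subset matter in the definitions below. *)

Section smoothness.
Context {R : realType}.

(* For finite-dimensional [V], this is the usual notion of a C^k map on the
   open set [U]. *)
Fixpoint is_Ck {V W : normedModType R} (k : nat) (U : set V) (f : V -> W)
    : Prop :=
  if k is k'.+1 then
    (forall x, U x -> differentiable f x) /\
    (forall v : V, is_Ck k' U (fun x => 'D_v f x))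
  else forall x, U x -> {for x, continuous f}.

(* Near each point of the arbitrary subset [A], [f] extends to a C^oo map. *)
Definition smooth_on {V W : normedModType R} (A : set V) (f : V -> W) : Prop :=
  forall x, A x -> exists (U : set V) (F : V -> W),
    [/\ open U, U x, forall k, is_Ck k U F
      & forall y, A y -> U y -> F y = f y].

Definition diffeo_between {V W : normedModType R} (A : set V) (B : set W)
    (g : V -> W) : Prop :=
  exists h : W -> V,
    [/\ forall x, A x -> B (g x) /\ h (g x) = x,
        forall y, B y -> A (h y) /\ g (h y) = y,
        smooth_on A g & smooth_on B h].

Definition diffeomorphic {V W : normedModType R} (A : set V) (B : set W)
    : Prop := exists g : V -> W, diffeo_between A B g.

End smoothness.

Section manifolds.
Context {R : realType} {p q : nat}.
Local Notation E := 'M[R]_(p, q).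
Implicit Types (M : set E) (x v w : E).

(* A diffeomorphism from an open subset [param_dom] of R^param_dim onto a
   relatively open subset of [M], sending [param_base] to [x]. *)
Record parametrization M x := Parametrization {
  param_dim : nat;
  param_dom : set 'rV[R]_param_dim;
  param_map : 'rV[R]_param_dim -> E;
  param_base : 'rV[R]_param_dim;
  param_dom_open : open param_dom;
  param_dom_base : param_dom param_base;
  param_map_base : param_map param_base = x;
  param_map_diffeo : exists U : set E,
    open U /\ diffeo_between param_dom (M `&` U) param_map
}.

Arguments param_dim {M x} c : rename.
Arguments param_dom {M x} c : rename.
Arguments param_map {M x} c : rename.
Arguments param_base {M x} c : rename.

Definition smooth_manifold M : Prop :=
  exists d : nat, forall x, M x ->
    exists c : parametrization M x, param_dim c = d.

Definition tangent_space M x : set E :=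
  [set v | exists (c : parametrization M x) (u : 'rV[R]_(param_dim c)),
     v = 'D_u (param_map c) (param_base c)].

(* The differential of f : M -> R at [x], applied to a tangent vector [v].
   When [M] is a manifold, [f] is smooth and [v] is tangent to [M], the set is
   a singleton by the chain rule. *)
Definition mdiff M (f : E -> R) x v : R :=
  xget 0 [set r | exists (c : parametrization M x) (u : 'rV[R]_(param_dim c)),
     v = 'D_u (param_map c) (param_base c) /\
     r = 'D_u (f \o param_map c) (param_base c)].

Definition critical_locus M (f : E -> R) : set E :=
  [set x | M x /\ forall v, tangent_space M x v -> mdiff M f x v = 0].

(* The Hessian of f : M -> R at a critical point [x], as a bilinear form on
   the tangent space of [M] at [x]: the second derivative of [f] read in a
   local parametrization.  The set is a singleton because the first-order
   terms of the change of coordinates vanish at a critical point. *)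
Definition hessian M (f : E -> R) x v w : R :=
  xget 0 [set r | exists (c : parametrization M x) (s t : 'rV[R]_(param_dim c)),
     [/\ v = 'D_s (param_map c) (param_base c),
         w = 'D_t (param_map c) (param_base c)
       & r = 'D_s (fun y => 'D_t (f \o param_map c) y) (param_base c)]].

Definition hessian_kernel M (f : E -> R) x : set E :=
  [set v | tangent_space M x v /\
     forall w, tangent_space M x w -> hessian M f x v w = 0].

Definition hessian_neg_def_on M (f : E -> R) x (V : {vspace E}) : Prop :=
  (forall v, v \in V -> tangent_space M x v) /\
  (forall v, v \in V -> v != 0 -> hessian M f x v v < 0).

Definition hessian_has_index M (f : E -> R) x (k : nat) : Prop :=
  (exists V : {vspace E}, hessian_neg_def_on M f x V /\ \dim V = k) /\
  (forall V : {vspace E}, hessian_neg_def_on M f x V -> (\dim V <= k)%N).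

(* The disjoint union is one of topological spaces: each piece is open in [C].
   Pieces may have different dimensions. *)
Definition disjoint_union_of_submanifolds (C : set E) : Prop :=
  exists (I : Type) (F : I -> set E),
    [/\ C = \bigcup_i F i, trivIset setT F,
        forall i, exists U : set E, open U /\ F i = C `&` U
      & forall i, smooth_manifold (F i)].

Definition Morse_Bott M (f : E -> R) : Prop :=
  [/\ smooth_manifold M, smooth_on M f,
      disjoint_union_of_submanifolds (critical_locus M f)
    & forall x, critical_locus M f x ->
        hessian_kernel M f x = tangent_space (critical_locus M f) x].

End manifolds.

Arguments param_dim {R p q M x} c : rename.
Arguments param_dom {R p q M x} c : rename.
Arguments param_map {R p q M x} c : rename.
Arguments param_base {R p q M x} c : rename.

Section special_orthogonal.
Variable R : realType.

Definition SO (n : nat) : set 'M[R]_n :=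
  [set X | X *m X^T = 1%:M /\ \det X = 1].

Definition last_ord (n : nat) (n_gt1 : (1 < n)%N) : 'I_n :=
  Ordinal (etrans (ltn_predL n) (ltnW n_gt1)).

Definition corner (n : nat) (n_gt1 : (1 < n)%N) (X : 'M[R]_n) : R :=
  X (last_ord n_gt1) (last_ord n_gt1).

End special_orthogonal.

Arguments SO R n : clear implicits.

(* Main.v *)
(** Multiplying a point X of SO(n) by the Cayley transform
    A |-> (1 - A) (1 + A)^-1 of skew-symmetric matrices gives a rational chart
    of SO(n) at X, with tangent vectors A X.  Let f be the coordinate X_ii.
    Testing df on A X with A = E_ik - E_ki shows that X is critical iff the
    i-th column of X is +-e_i, i.e. X_ii = +-1; restricted to the A with
    A e_i = 0 the same chart parametrizes the critical locus.  Differentiating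
    c c^T = 1 twice along any parametrization c of SO(n) at a critical point
    gives Hess f (v, w) = - X_ii <row_i v, row_i w>: its kernel consists of the
    tangent vectors with zero i-th row, it is positive semidefinite if
    X_ii = -1, and if X_ii = 1 its index is the dimension n - 1 of the space of
    possible i-th rows. *)

From HB Require Import structures.
Require Import Defs.
From mathcomp Require Import all_boot all_order all_algebra.
From mathcomp Require Import all_classical all_reals all_analysis.

Set Implicit Arguments.
Unset Strict Implicit.
Unset Printing Implicit Defensive.

Import Order.TTheory GRing.Theory Num.Theory.
Import numFieldNormedType.Exports.

Local Open Scope classical_set_scope.
Local Open Scope ring_scope.

(** * Calculus of C^k maps *)

Section smooth_calculus.
Context {R : realType}.
Implicit Types V W : normedModType R.

(** The little-o expansion of [f] at [x] is also one of [g], so uniqueness of the differential gives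
    ['d g x = 'd f x]. *)
Lemma near_eq_differentiable V W (f g : V -> W) (x : V) :
  (\forall y \near x, f y = g y) -> differentiable f x -> differentiable g x.
Proof.
move=> fg df; have gfx : g x = f x by rewrite (nbhs_singleton fg).
have [dfc dfe] := (diff_locallyP x f).1 df.
have dge : g \o shift x = cst (g x) + 'd f x +o_ 0 id.
  apply/eqaddoP => _/posnumP[e].
  have /eqaddoP /(_ e%:num) /(_ [gt0 of e%:num]) := dfe.
  apply: filter_app; rewrite gfx.
  have : \forall h \near (0 : V), f (h + x) = g (h + x).
    by have := fg; rewrite (near_shift 0) subr0.
  by apply: filter_app; near=> h => /= fgh; rewrite !fctE /= fgh.
have dgf : 'd g x = 'd f x :> (V -> W) by apply: diff_unique dge.
by apply/diff_locallyP; rewrite dgf.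
Unshelve. all: by end_near. Qed.

Lemma is_Ck_eq V W k (U : set V) (f g : V -> W) : open U ->
  (forall x, U x -> f x = g x) -> is_Ck k U f -> is_Ck k U g.
Proof.
move=> oU; elim: k f g => [|k IH] f g fg /=.
  move=> fc x Ux; rewrite /prop_for /continuous_at -(fg _ Ux).
  apply: cvg_trans (fc x Ux); apply: near_eq_cvg.
  by apply: filterS (open_nbhs_nbhs (conj oU Ux)) => y /fg.
move=> [df Df].
have nfg x : U x -> \forall y \near x, f y = g y.
  by move=> Ux; apply: filterS (open_nbhs_nbhs (conj oU Ux)) => y /fg.
(* [near_eq_derive] asks for a nonzero direction, so [v = 0] is treated apart. *)
split=> [x Ux|v]; first exact: near_eq_differentiable (nfg x Ux) (df x Ux).
apply: IH (Df v) => x Ux; have [->|v0] := eqVneq v 0; first by rewrite !derive0.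
exact: near_eq_derive (nfg x Ux).
Qed.

Lemma is_Ck_sub V W k (U U' : set V) (f : V -> W) :
  U' `<=` U -> is_Ck k U f -> is_Ck k U' f.
Proof.
move=> sU; elim: k f => [|k IH] f /=; first by move=> fc x /sU /fc.
by move=> [df Df]; split=> [x /sU /df|v] //; apply: IH.
Qed.

Lemma is_CkW V W k (U : set V) (f : V -> W) : is_Ck k.+1 U f -> is_Ck k U f.
Proof.
elim: k f => [|k IH] f [df Df]; first by move=> x /df /differentiable_continuous.
by split=> // v; apply/IH/Df.
Qed.

Lemma is_Ck_cst V W k (U : set V) (a : W) : is_Ck k U (cst a : V -> W).
Proof.
elim: k a => [|k IH] a /=; first by move=> x _; apply: cst_continuous.
split=> // v; rewrite (_ : (fun x => _) = cst 0) //.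
by apply/funext => x; rewrite derive_cst.
Qed.

(* Closure properties of C^k are proved by induction on k, rewriting the
   derivative on the open set with the usual rule; [is_Ck_eq] transfers along
   that rewriting. *)
Lemma is_CkD V W k (U : set V) (f g : V -> W) : open U ->
  is_Ck k U f -> is_Ck k U g -> is_Ck k U (fun x => f x + g x).
Proof.
move=> oU; elim: k f g => [|k IH] f g.
  by move=> fc gc x Ux; apply: continuousD; [apply: fc|apply: gc].
move=> [df Df] [dg Dg]; split=> [x Ux|v].
  by apply: differentiableD; [apply: df|apply: dg].
apply: is_Ck_eq (IH _ _ (Df v) (Dg v)) => // x Ux.
by rewrite -deriveD //; apply/diff_derivable; [apply: df|apply: dg].
Qed.

(** [L] is unbundled so that coordinates, transposition and multiplication by a fixed matrix can be
    supplied as plain functions. *)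
Lemma derive_linear_comp V W W' (L : W -> W') (f : V -> W) x v :
  linear L -> continuous L -> differentiable f x ->
  'D_v (fun y => L (f y)) x = L ('D_v f x).
Proof.
move=> lL Lc df; pose lM := GRing.isLinear.Build _ _ _ _ L lL.
pose L' : {linear W -> W'} := HB.pack L lM.
have dL y : differentiable L' y by apply: linear_differentiable.
have dLE : 'd L' (f x) = L' :> (W -> W') by apply: diff_lin.
rewrite -[fun y => _]/(L' \o f) -[L _]/(L' _) !deriveE //.
  by rewrite diff_comp // [LHS]/comp dLE.
exact: differentiable_comp.
Qed.

Lemma is_Ck_linear_comp V W W' k U (L : W -> W') (f : V -> W) :
  linear L -> continuous L -> open U -> is_Ck k U f ->
  is_Ck k U (fun x => L (f x)).
Proof.
move=> lL Lc oU; pose lM := GRing.isLinear.Build _ _ _ _ L lL.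
pose L' : {linear W -> W'} := HB.pack L lM.
elim: k f => [|k IH] f.
  by move=> fc x Ux; apply: continuous_comp; [apply: fc|apply: Lc].
move=> [df Df]; split=> [x Ux|v].
  apply: differentiable_comp; first exact: df.
  exact: (@linear_differentiable _ _ _ L').
apply: is_Ck_eq (IH _ (Df v)) => // x Ux.
by rewrite (derive_linear_comp _ lL Lc (df x Ux)).
Qed.

Lemma is_Ck_id V k (U : set V) : is_Ck k U (@idfun V).
Proof.
case: k => [|k]; first by move=> x _; apply: cvg_id.
split=> [x _|v]; first exact: (@ex_diff _ _ _ _ _ _ _ (is_diff_id x)).
rewrite (_ : (fun x => _) = cst v); first exact: is_Ck_cst.
by apply/funext => x; rewrite derive_id.
Qed.

Lemma is_CkM V k (U : set V) (f g : V -> R) : open U ->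
  is_Ck k U f -> is_Ck k U g -> is_Ck k U (fun x => f x * g x).
Proof.
move=> oU; elim: k f g => [|k IH] f g.
  by move=> fc gc x Ux; apply: continuousM; [apply: fc|apply: gc].
move=> fk gk; have [df Df] := fk; have [dg Dg] := gk; split=> [x Ux|v].
  by apply: differentiableM; [apply: df|apply: dg].
(* Each Leibniz term pairs a C^k derivative with an undifferentiated factor, weakened from C^(k+1)
   to C^k. *)
have fDg := is_CkD oU (IH _ _ (is_CkW fk) (Dg v)) (IH _ _ (is_CkW gk) (Df v)).
apply: is_Ck_eq fDg => // x Ux.
rewrite -[fun x => f x * g x]/(f * g) deriveM //; apply/diff_derivable.
  exact: df.
exact: dg.
Qed.

Lemma is_CkV V k (U : set V) (f : V -> R) : open U -> (forall x, U x -> f x != 0) ->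
  is_Ck k U f -> is_Ck k U (fun x => (f x)^-1).
Proof.
move=> oU f0; elim: k => [|k IH].
  by move=> fc x Ux; apply: continuousV; [apply: f0|apply: fc].
move=> fk; have [df Df] := fk; split=> [x Ux|v].
  by apply: differentiableV; [apply: df|apply: f0].
have fVk := IH (is_CkW fk).
(* The derivative is [- f^-1 * f^-1 * 'D_v f], whose factors [f^-1] are C^k by induction. *)
have := is_CkM oU (is_Ck_cst k U (-1 : R)) (is_CkM oU (is_CkM oU fVk fVk) (Df v)).
apply: is_Ck_eq => // x Ux /=.
rewrite deriveV ?f0//; last exact/diff_derivable/df.
by rewrite mulN1r scaleNr -exprVn expr2.
Qed.

Lemma is_Ck_sum V W k (U : set V) (I : Type) (r : seq I) (P : pred I) (f : I -> V -> W) :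
  open U -> (forall i, is_Ck k U (f i)) ->
  is_Ck k U (fun x => \sum_(i <- r | P i) f i x).
Proof.
move=> oU fk; elim: r => [|i r IH].
  rewrite (_ : (fun x => _) = cst 0); first exact: is_Ck_cst.
  by apply/funext => x; rewrite big_nil.
case Pi : (P i).
  rewrite (_ : (fun x => _) = fun x => f i x + \sum_(i <- r | P i) f i x).
    exact: is_CkD.
  by apply/funext => x; rewrite big_cons Pi.
rewrite (_ : (fun x => _) = fun x => \sum_(i <- r | P i) f i x) //.
by apply/funext => x; rewrite big_cons Pi.
Qed.

Lemma is_Ck_prod V k (U : set V) (I : Type) (r : seq I) (P : pred I) (f : I -> V -> R) :
  open U -> (forall i, is_Ck k U (f i)) ->
  is_Ck k U (fun x => \prod_(i <- r | P i) f i x).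
Proof.
move=> oU fk; elim: r => [|i r IH].
  rewrite (_ : (fun x => _) = cst 1); first exact: is_Ck_cst.
  by apply/funext => x; rewrite big_nil.
case Pi : (P i).
  rewrite (_ : (fun x => _) = fun x => f i x * \prod_(i <- r | P i) f i x).
    exact: is_CkM.
  by apply/funext => x; rewrite big_cons Pi.
rewrite (_ : (fun x => _) = fun x => \prod_(i <- r | P i) f i x) //.
by apply/funext => x; rewrite big_cons Pi.
Qed.

End smooth_calculus.

(** * Smoothness and derivatives of matrix operations *)

Section smooth_matrices.
Context {R : realType}.
Implicit Types V W : normedModType R.

Lemma coord_linear m n i j : linear (fun A : 'M[R]_(m, n) => A i j).
Proof. by move=> a A B; rewrite !mxE. Qed.

Lemma scalel_linear W (w : W) : linear (fun a : R => a *: w).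
Proof. by move=> a x y; rewrite scalerDl scalerA. Qed.

(** Expanding in the basis [delta_mx i j] makes [L] a finite sum of continuous coordinates times
    fixed vectors. *)
Lemma mx_linear_continuous W m n (L : 'M[R]_(m, n) -> W) :
  linear L -> continuous L.
Proof.
move=> lL; pose lM := GRing.isLinear.Build _ _ _ _ L lL.
pose L' : {linear _ -> W} := HB.pack L lM.
have LE (A : 'M[R]_(m, n)) : \sum_i \sum_j A i j *: L' (delta_mx i j) = L' A.
  rewrite [in RHS](matrix_sum_delta A) linear_sum; apply: eq_bigr => i _.
  by rewrite linear_sum; apply: eq_bigr => j _; rewrite linearZ.
suff: is_Ck 0 setT L by move=> /= Lc x; apply: Lc.
apply: (is_Ck_eq (f := fun A : 'M[R]_(m, n) => \sum_i \sum_j A i j *: L (delta_mx i j))).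
- exact: openT.
- by move=> A _; apply: LE.
apply: is_Ck_sum => [|i]; first exact: openT.
apply: is_Ck_sum => [|j]; first exact: openT.
pose c (A : 'M[R]_(m, n)) := A i j.
have ck : is_Ck 0 setT c by move=> A _; apply: coord_continuous.
exact: (is_Ck_linear_comp (scalel_linear (L (delta_mx i j)))
  (@scalel_continuous _ _ _) openT ck).
Qed.

Lemma is_Ck_mx_linear W m n k U (L : 'M[R]_(m, n) -> W) :
  linear L -> open U -> is_Ck k U L.
Proof.
move=> lL oU.
exact: (is_Ck_linear_comp lL (mx_linear_continuous lL) oU (is_Ck_id k U)).
Qed.

Lemma is_Ck_coord V m n k U (F : V -> 'M[R]_(m, n)) i j : open U ->
  is_Ck k U F -> is_Ck k U (fun x => F x i j).
Proof.
move=> oU; apply: (is_Ck_linear_comp (L := fun A : 'M[R]_(m, n) => A i j)) => //.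
  exact: coord_linear.
exact: coord_continuous.
Qed.

Lemma is_Ck_mx V m n k U (F : V -> 'M[R]_(m, n)) : open U ->
  (forall i j, is_Ck k U (fun x => F x i j)) -> is_Ck k U F.
Proof.
move=> oU Fk.
apply: (is_Ck_eq (f := fun x => \sum_i \sum_j F x i j *: delta_mx i j)) => //.
  by move=> x _; rewrite -matrix_sum_delta.
apply: is_Ck_sum => // i; apply: is_Ck_sum => // j.
exact: (is_Ck_linear_comp (scalel_linear (delta_mx i j : 'M[R]_(m, n)))
  (@scalel_continuous _ _ _) oU (Fk i j)).
Qed.

Lemma is_Ck_mulmx V m n p k U (F : V -> 'M[R]_(m, n)) (G : V -> 'M[R]_(n, p)) :
  open U -> is_Ck k U F -> is_Ck k U G -> is_Ck k U (fun x => F x *m G x).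
Proof.
move=> oU Fk Gk; apply: is_Ck_mx => // i j.
apply: (is_Ck_eq (f := fun x => \sum_l F x i l * G x l j)) => //.
  by move=> x _; rewrite mxE.
by apply: is_Ck_sum => // l; apply: is_CkM => //; apply: is_Ck_coord.
Qed.

Lemma is_Ck_det V n k U (F : V -> 'M[R]_n) : open U ->
  is_Ck k U F -> is_Ck k U (fun x => \det (F x)).
Proof.
move=> oU Fk; apply: is_Ck_sum => // s.
apply: is_CkM => //; first exact: (@is_Ck_cst _ V R).
by apply: is_Ck_prod => // i; apply: is_Ck_coord.
Qed.

(** Cramer's rule: on [U] the inverse is the adjugate divided by the determinant, both polynomial in
    the entries. *)
Lemma is_Ck_invmx V n k U (F : V -> 'M[R]_n) : open U ->
  (forall x, U x -> F x \in unitmx) ->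
  is_Ck k U F -> is_Ck k U (fun x => invmx (F x)).
Proof.
move=> oU uF Fk; apply: is_Ck_mx => // i j.
apply: (is_Ck_eq (f := fun x => (\det (F x))^-1 * \adj (F x) i j)) => //.
  by move=> x Ux; rewrite /invmx uF // !mxE.
apply: is_CkM => //.
  apply: is_CkV => //; last exact: is_Ck_det.
  by move=> x Ux; have := uF x Ux; rewrite unitmxE unitfE.
apply: (is_Ck_eq (f := fun x => cofactor (F x) j i)) => //.
  by move=> x Ux; rewrite mxE.
apply: is_CkM => //; first exact: (@is_Ck_cst _ V R).
apply: is_Ck_det => //; apply: is_Ck_mx => // a b.
by apply: (is_Ck_eq (f := fun x => F x (lift j a) (lift i b))) => [||] //;
   [move=> x _; rewrite !mxE|apply: is_Ck_coord].
Qed.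

Lemma open_unitmx V n (F : V -> 'M[R]_n) : is_Ck 0 setT F ->
  open [set x | F x \in unitmx].
Proof.
move=> Fc; rewrite (_ : [set _ | _] = (fun x => \det (F x)) @^-1` [set r | r != 0]).
  apply: open_comp; last exact: open_neq.
  by move=> x _; apply: (is_Ck_det openT Fc).
by apply/seteqP; split => x /=; rewrite unitmxE unitfE.
Qed.

Lemma derive_coord V m n (F : V -> 'M[R]_(m, n)) x v i j :
  differentiable F x -> 'D_v (fun y => F y i j) x = 'D_v F x i j.
Proof.
apply: (derive_linear_comp (L := fun A : 'M[R]_(m, n) => A i j)).
  exact: coord_linear.
exact: coord_continuous.
Qed.

Lemma derive_mulmx V m n p (F : V -> 'M[R]_(m, n)) (G : V -> 'M[R]_(n, p)) x v :
  differentiable F x -> differentiable G x ->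
  'D_v (fun y => F y *m G y) x = 'D_v F x *m G x + F x *m 'D_v G x.
Proof.
move=> dF dG.
have dFe i j : derivable (fun y => F y i j) x v.
  by move: i j; apply/derivable_mxP/diff_derivable.
have dGe i j : derivable (fun y => G y i j) x v.
  by move: i j; apply/derivable_mxP/diff_derivable.
have FGE i j : (fun y => (F y *m G y) i j) =
    \sum_l ((fun y => F y i l) * (fun y => G y l j)).
  by apply/funext => y; rewrite mxE fct_sumE.
have dFG : derivable (fun y => F y *m G y) x v.
  by apply/derivable_mxP => i j; rewrite FGE; apply: derivable_sum => l;
    apply: derivableM.
rewrite derive_mx //; apply/matrixP => i j; rewrite !mxE FGE derive_sum; last first.
  by move=> l; apply: derivableM.
rewrite -big_split; apply: eq_bigr => l _ /=.
by rewrite deriveM // !derive_coord // addrC [G x l j *: _]mulrC.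
Qed.

End smooth_matrices.

(** * The Cayley transform *)

Section cayley_transform.
Context {R : realType} {n : nat}.
Implicit Types A Q : 'M[R]_n.

Definition cayley A : 'M[R]_n := (1%:M - A) *m invmx (1%:M + A).

Lemma mulmx_tr_eq0 (v : 'rV[R]_n) : v *m v^T = 0 -> v = 0.
Proof.
move/matrixP/(_ 0 0); rewrite !mxE => v0; apply/rowP => j; rewrite mxE.
have /eqP : \sum_k v 0 k ^+ 2 = 0.
  by rewrite -[RHS]v0; apply: eq_bigr => k _; rewrite mxE expr2.
rewrite psumr_eq0 => [|k _]; last exact: sqr_ge0.
by move/allP/(_ j); rewrite mem_index_enum sqrf_eq0 => /(_ isT)/eqP.
Qed.

Lemma skew_form_eq0 A (v : 'rV[R]_n) : A^T = - A -> v *m A *m v^T = 0.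
Proof.
move=> skA; apply/matrixP => i j; rewrite !ord1 mxE; set a := v *m A *m v^T.
have : a^T = - a by rewrite /a !trmx_mul trmxK skA mulNmx mulmxN mulmxA.
move/matrixP/(_ 0 0); rewrite !mxE => /eqP.
by rewrite -addr_eq0 -mulr2n mulrn_eq0 /= => /eqP.
Qed.

(** If [v (1 + A) = 0] then [v v^T = - v A v^T], which vanishes because [A] is skew. *)
Lemma skew_unitmx A : A^T = - A -> 1%:M + A \in unitmx.
Proof.
move=> skA; rewrite -row_free_unit; apply: inj_row_free => v.
rewrite mulmxDr mulmx1 => /eqP; rewrite addr_eq0 => /eqP vA.
by apply: mulmx_tr_eq0; rewrite {1}vA mulNmx skew_form_eq0 ?oppr0.
Qed.

Lemma comm_cayley A : (1%:M + A) *m (1%:M - A) = (1%:M - A) *m (1%:M + A).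
Proof.
rewrite [LHS]mulmxBr [RHS]mulmxBl mulmx1 mul1mx.
by rewrite mulmxDl mulmxDr mul1mx mulmx1.
Qed.

Lemma cayleyMr A : 1%:M + A \in unitmx -> cayley A *m (1%:M + A) = 1%:M - A.
Proof. by move=> uA; rewrite mulmxKV. Qed.

Lemma cayleyMl A : 1%:M + A \in unitmx -> (1%:M + A) *m cayley A = 1%:M - A.
Proof. by move=> uA; rewrite mulmxA comm_cayley mulmxK. Qed.

(** Since [(1 + A)^T = 1 - A], the two factors of [cayley A] are transposes up to inversion, hence
    have inverse determinants. *)
Lemma cayley_orthogonal A : A^T = - A ->
  cayley A *m (cayley A)^T = 1%:M /\ \det (cayley A) = 1.
Proof.
move=> skA; have uA := skew_unitmx skA.
have trA : (1%:M + A)^T = 1%:M - A by rewrite linearD /= trmx1 skA.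
have trA' : (1%:M - A)^T = 1%:M + A by rewrite linearB /= trmx1 skA opprK.
split.
  apply: mulmx1C; apply: (can_inj (mulmxK uA)).
  rewrite mul1mx -mulmxA cayleyMr // -{1}trA -trmx_mul cayleyMl //.
have := congr1 determinant (cayleyMr uA).
rewrite det_mulmx -trA det_tr => /(canRL (mulfK _)) -> //.
  by rewrite divff //; move: uA; rewrite unitmxE unitfE.
by move: uA; rewrite unitmxE unitfE.
Qed.

Lemma cayley_skew Q : Q *m Q^T = 1%:M -> 1%:M + Q \in unitmx ->
  (cayley Q)^T = - cayley Q.
Proof.
move=> QQ uQ; have uQ' : (1%:M + Q)^T \in unitmx by rewrite unitmx_tr.
apply: (can_inj (mulKmx uQ')); rewrite mulmxN -trmx_mul cayleyMr //.
(* Orthogonality of [Q] enters here; it moves the transpose off the factor [1 + Q]. *)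
have -> : (1%:M + Q)^T = Q^T *m (1%:M + Q).
  by rewrite linearD /= trmx1 mulmxDr mulmx1 (mulmx1C QQ) addrC.
rewrite -mulmxA cayleyMl // mulmxBr mulmx1 (mulmx1C QQ).
by rewrite linearB /= trmx1 opprB.
Qed.

(** Shows that [1 + cayley A] is again invertible, so that the transform can be applied twice; it is
    then an involution. *)
Lemma cayley_addr1 A : 1%:M + A \in unitmx ->
  1%:M + cayley A = 2 *: invmx (1%:M + A).
Proof.
move=> uA; apply: (can_inj (mulmxK uA)).
rewrite -scalemxAl mulVmx // mulmxDl cayleyMr // mul1mx.
by rewrite addrACA subrr addr0 scaler_nat mulr2n.
Qed.

Lemma cayley_unitmx A : 1%:M + A \in unitmx -> 1%:M + cayley A \in unitmx.
Proof.
by move=> uA; rewrite cayley_addr1 // unitmxZ ?unitfE ?pnatr_eq0 // unitmx_inv.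
Qed.

Lemma cayleyK A : 1%:M + A \in unitmx -> cayley (cayley A) = A.
Proof.
move=> uA; have uC := cayley_unitmx uA.
apply: (can_inj (mulmxK uC)); rewrite cayleyMr // cayley_addr1 // -scalemxAr.
apply: (can_inj (mulmxK uA)); rewrite mulmxBl cayleyMr // mul1mx -scalemxAl.
by rewrite mulmxKV // opprB addrC addrA subrK scaler_nat mulr2n.
Qed.

Lemma cayley0 : cayley 0 = 1%:M.
Proof. by rewrite /cayley subr0 addr0 invmx1 mulmx1. Qed.

End cayley_transform.

(** * Parametrizations of submanifolds of the orthogonal group *)

Section derivatives_of_parametrizations.
Context {R : realType}.

Lemma derive_eq_open (V W : normedModType R) (U : set V) (f g : V -> W) x v :
  open U -> U x -> (forall y, U y -> f y = g y) -> 'D_v f x = 'D_v g x.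
Proof.
move=> oU Ux fg; have [->|v0] := eqVneq v 0; first by rewrite !derive0.
apply: near_eq_derive => //.
by apply: filterS (open_nbhs_nbhs (conj oU Ux)) => y /fg.
Qed.

Context {p q : nat}.
Implicit Types M : set 'M[R]_(p, q).

(** [smooth_on] only provides a local smooth extension; on its intersection with the open
    [param_dom] the extension is [param_map] itself. *)
Lemma parametrization_Ck M x (c : parametrization M x) :
  exists N : set 'rV[R]_(param_dim c),
    [/\ open N, N (param_base c), forall y, N y -> M (param_map c y)
      & forall k, is_Ck k N (param_map c)].
Proof.
have [U [oU [h [cU _ csm _]]]] := param_map_diffeo c.
have [N [F [oN Nb Fk Fc]]] := csm _ (param_dom_base c).
have oND : open (N `&` param_dom c) by exact: openI oN (@param_dom_open _ _ _ _ _ c).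
exists (N `&` param_dom c); split => //.
- by split => //; apply: param_dom_base.
- by move=> y [_ /cU[[]]].
- move=> k; apply: (is_Ck_eq (f := F)) => //; first by move=> y [Ny /Fc]; apply.
  by apply: is_Ck_sub (Fk k) => y [].
Qed.

Lemma tr_linear : linear (@trmx R p q).
Proof. by move=> a A B; rewrite linearP. Qed.

Lemma derive_tr (V : normedModType R) (F : V -> 'M[R]_(p, q)) x v :
  differentiable F x -> 'D_v (fun y => (F y)^T) x = ('D_v F x)^T.
Proof.
exact: derive_linear_comp tr_linear (mx_linear_continuous tr_linear).
Qed.

Lemma differentiable_tr (V : normedModType R) (F : V -> 'M[R]_(p, q)) x :
  differentiable F x -> differentiable (fun y => (F y)^T) x.
Proof.
move=> dF; have [] : is_Ck 1 setT (@trmx R p q).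
  exact: is_Ck_mx_linear tr_linear openT.
by move=> dt _; apply: (differentiable_comp (g := @trmx R p q)) dF (dt _ I).
Qed.

(** A coordinate is linear, so every parametrization representing [v] yields [v i j], and [xget]
    picks from a singleton. *)
Lemma mdiff_coord M x v i j : tangent_space M x v ->
  mdiff M (fun X => X i j) x v = v i j.
Proof.
move=> [c [u vE]]; apply: xget_subset1.
  exists c, u; split=> //; have [N [oN Nb _ Nk]] := parametrization_Ck c.
  by rewrite vE derive_coord //; have [+ _] := Nk 1%N; apply.
move=> r1 r2 [c1 [u1 [v1 ->]]] [c2 [u2 [v2 ->]]].
have E (c' : parametrization M x) u' : v = 'D_u' (param_map c') (param_base c') ->
    'D_u' ((fun X : 'M[R]_(p, q) => X i j) \o param_map c') (param_base c') = v i j.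
  move=> ->; have [N' [oN' Nb' _ Nk']] := parametrization_Ck c'.
  by rewrite derive_coord //; have [+ _] := Nk' 1%N; apply.
by rewrite !E.
Qed.

End derivatives_of_parametrizations.

(** The hypothesis is the constraint [F F^T = 1] differentiated twice at [x]: [A] and [B] stand for
    first derivatives of [F], [W] for the mixed second one. *)
Lemma orthogonal_diag (R : realType) (n : nat) (x W A B : 'M[R]_n) i eps :
  W *m x^T + A *m B^T + (B *m A^T + x *m W^T) = 0 -> eps ^+ 2 = 1 ->
  row i x = eps *: delta_mx 0 i ->
  W i i = - eps * \sum_k B i k * A i k.
Proof.
move=> + eps2 xi; set P := W *m x^T + A *m B^T.
(* the hypothesis is [P + P^T = 0], so [P] has zero diagonal *)
have -> : B *m A^T + x *m W^T = P^T.
  by rewrite linearD /= !trmx_mul !trmxK addrC.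
move/matrixP/(_ i i); rewrite mxE [P^T i i]mxE [RHS]mxE => /eqP.
rewrite -mulr2n mulrn_eq0 /= mxE => /eqP.
have -> : (W *m x^T) i i = W i i * eps.
  have -> : (W *m x^T) i i = (row i W *m (row i x)^T) 0 0.
    by rewrite !mxE; apply: eq_bigr => k _; rewrite !mxE.
  rewrite xi linearZ /= trmx_delta -scalemxAr mxE -colE !mxE mulrC.
  by [].
have -> : (A *m B^T) i i = \sum_k B i k * A i k.
  by rewrite mxE; apply: eq_bigr => k _; rewrite mxE mulrC.
move=> /eqP; rewrite addr_eq0 => /eqP We.
by rewrite mulNr -mulrN -We mulrC -mulrA -expr2 eps2 mulr1.
Qed.

(** * Differentiating the orthogonality constraint *)

Section orthogonal_constraint.
Context {R : realType} {n : nat} {V : normedModType R}.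
Variables (N : set V) (F : V -> 'M[R]_n).
Hypotheses (oN : open N) (F2 : is_Ck 2 N F).
Hypothesis FF : forall y, N y -> F y *m (F y)^T = 1%:M.

Lemma orthogonal_derive1 t y : N y ->
  'D_t F y *m (F y)^T + F y *m ('D_t F y)^T = 0.
Proof.
move=> Ny; have dF : differentiable F y by have [+ _] := F2; apply.
rewrite -[in X in _ + X]derive_tr // -derive_mulmx //; last exact: differentiable_tr.
rewrite (derive_eq_open (U := N) (g := cst 1%:M)) //.
exact: derive_cst.
Qed.

Lemma orthogonal_derive2 s t y : N y ->
  'D_s ('D_t F) y *m (F y)^T + 'D_t F y *m ('D_s F y)^T +
  ('D_s F y *m ('D_t F y)^T + F y *m ('D_s ('D_t F) y)^T) = 0.
Proof.
move=> Ny; have dF z : N z -> differentiable F z by have [+ _] := F2; apply.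
have Ft : is_Ck 1 N ('D_t F) by have [_] := F2; apply.
have dFt : differentiable ('D_t F) y by have [+ _] := Ft; apply.
have dFT := differentiable_tr (dF _ Ny); have dFtT := differentiable_tr dFt.
have Tk k (G : V -> 'M[R]_n) : is_Ck k N G -> is_Ck k N (fun z => (G z)^T).
  by apply: is_Ck_linear_comp oN; [exact: tr_linear|exact/mx_linear_continuous/tr_linear].
have dM1 : differentiable (fun z => 'D_t F z *m (F z)^T) y.
  have [+ _] : is_Ck 1 N (fun z => 'D_t F z *m (F z)^T).
    exact: is_Ck_mulmx oN Ft (Tk _ _ (is_CkW F2)).
  by apply.
have dM2 : differentiable (fun z => F z *m ('D_t F z)^T) y.
  have [+ _] : is_Ck 1 N (fun z => F z *m ('D_t F z)^T).
    exact: is_Ck_mulmx oN (is_CkW F2) (Tk _ _ Ft).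
  by apply.
rewrite -[in X in _ + X + _]derive_tr; last exact: dF.
rewrite -[in X in _ + (_ + X)]derive_tr // -derive_mulmx //.
rewrite -derive_mulmx //; last exact: dF.
rewrite -deriveD; [|exact: diff_derivable..].
(* The first-order identity holds on all of [N], so its left side can be differentiated as a
   constant. *)
rewrite (derive_eq_open (U := N) (g := cst 0)) //; last first.
  by move=> z Nz; apply: orthogonal_derive1.
exact: derive_cst.
Qed.

End orthogonal_constraint.

Section orthogonal_submanifolds.
Context {R : realType} {n : nat}.
Variable M : set 'M[R]_n.
Hypothesis Morth : forall X, M X -> X *m X^T = 1%:M.

Lemma tangent_space_skew x v : tangent_space M x v ->
  (v *m x^T)^T = - (v *m x^T).
Proof.
move=> [c [u ->]]; have [N [oN Nb NM Nk]] := parametrization_Ck c.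
have := @orthogonal_derive1 _ _ _ N _ oN (Nk 2) (fun y Ny => Morth (NM y Ny)) u _ Nb.
by rewrite param_map_base trmx_mul trmxK => /eqP; rewrite addrC addr_eq0 => /eqP.
Qed.

(** The twice differentiated constraint gives the same value in every parametrization. The existence
    premise asks for one parametrization realizing both [v] and [w]; without it the set under [xget]
    could be empty. *)
Lemma hessian_diag_coord x v w i eps : row i x = eps *: delta_mx 0 i -> eps ^+ 2 = 1 ->
  (exists (c : parametrization M x) (s t : 'rV_(param_dim c)),
    v = 'D_s (param_map c) (param_base c) /\
    w = 'D_t (param_map c) (param_base c)) ->
  hessian M (fun X => X i i) x v w = - eps * \sum_k v i k * w i k.
Proof.
move=> xi eps2 ex.
have E (c : parametrization M x) (s t : 'rV_(param_dim c)) :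
    'D_s (fun y => 'D_t ((fun X : 'M[R]_n => X i i) \o param_map c) y) (param_base c) =
    - eps * \sum_k 'D_s (param_map c) (param_base c) i k *
                   'D_t (param_map c) (param_base c) i k.
  have [N [oN Nb NM Nk]] := parametrization_Ck c.
  have [dF /(_ t) [dFt _]] := Nk 2.
  rewrite (derive_eq_open (U := N) (g := fun y => 'D_t (param_map c) y i i)) //;
    last by move=> y Ny; rewrite derive_coord //; apply: dF.
  rewrite derive_coord; last exact: dFt.
  apply: orthogonal_diag eps2 xi.
  have := orthogonal_derive2 oN (Nk 2) (fun y Ny => Morth (NM y Ny)) s t Nb.
  by rewrite param_map_base.
apply: xget_unique.
  by have [c [s [t [-> ->]]]] := ex; exists c, s, t; split=> //; rewrite E.
by move=> r [c [s [t [-> -> ->]]]]; rewrite E.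
Qed.

End orthogonal_submanifolds.

(** * Linear coordinates on a subspace *)

Section subspace_coordinates.
Context {R : realType} {V : vectType R} (S : {vspace V}).

Definition subspace_vec (u : 'rV[R]_(\dim S)) : V :=
  \sum_i u 0 i *: (vbasis S)`_i.

Definition subspace_coord (v : V) : 'rV[R]_(\dim S) :=
  \row_i coord (vbasis S) i v.

Lemma subspace_vec_linear : linear subspace_vec.
Proof.
move=> a u v; rewrite /subspace_vec scaler_sumr -big_split.
by apply: eq_bigr => i _; rewrite !mxE scalerDl scalerA.
Qed.

Lemma subspace_coord_linear : linear subspace_coord.
Proof. by move=> a u v; apply/rowP => i; rewrite !mxE linearP. Qed.

Lemma subspace_vec_mem u : subspace_vec u \in S.
Proof.
apply: memv_suml => i _; apply/memvZ/vbasis_mem/mem_nth.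
by rewrite size_tuple.
Qed.

Lemma subspace_vecK : cancel subspace_vec subspace_coord.
Proof.
move=> u; apply/rowP => i; rewrite mxE coord_sum_free //.
exact: basis_free (vbasisP S).
Qed.

Lemma subspace_coordK v : v \in S -> subspace_vec (subspace_coord v) = v.
Proof.
move=> Sv; rewrite [RHS](coord_vbasis Sv).
by apply: eq_bigr => i _; rewrite mxE.
Qed.

End subspace_coordinates.

(** * Cayley charts, for a submanifold [M] modelled on a space [S] of skew matrices *)

Section cayley_parametrization.
Context {R : realType} {n : nat}.
Variables (M : set 'M[R]_n) (X : 'M[R]_n) (S : {vspace 'M[R]_n}).
Hypotheses (XX : X *m X^T = 1%:M) (Sskew : forall A, A \in S -> A^T = - A).
Hypothesis SM : forall A, A \in S -> M (cayley A *m X).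
Hypothesis MS : forall Y, M Y -> 1%:M + Y *m X^T \in unitmx ->
  cayley (Y *m X^T) \in S.

Let L := @subspace_vec R _ S.
Let chart u := cayley (L u) *m X.

(** The domain of the inverse chart, which applies [cayley] again to [Y X^T]. *)
Let unit_domain : set 'M[R]_n := [set Y | 1%:M + Y *m X^T \in unitmx].

Let mulXT_linear : linear (fun Y : 'M[R]_n => Y *m X^T).
Proof. by move=> a Y Z; rewrite mulmxDl scalemxAl. Qed.

Let mulX_linear : linear (fun Y : 'M[R]_n => Y *m X).
Proof. by move=> a Y Z; rewrite mulmxDl scalemxAl. Qed.

Let is_Ck_1D k (V : normedModType R) (U : set V) (F : V -> 'M[R]_n) :
  open U -> is_Ck k U F -> is_Ck k U (fun x => 1%:M + F x).
Proof. by move=> oU Fk; apply: is_CkD => //; apply: is_Ck_cst. Qed.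

Let is_Ck_1B k (V : normedModType R) (U : set V) (F : V -> 'M[R]_n) :
  open U -> is_Ck k U F -> is_Ck k U (fun x => 1%:M - F x).
Proof.
move=> oU Fk; apply: is_Ck_1D => //.
have oppl : linear (fun A : 'M[R]_n => - A).
  by move=> a A B; rewrite opprD scalerN.
exact: is_Ck_linear_comp oppl (mx_linear_continuous oppl) oU Fk.
Qed.

Let is_Ck_cayley k (V : normedModType R) (U : set V) (F : V -> 'M[R]_n) :
  open U -> (forall x, U x -> 1%:M + F x \in unitmx) ->
  is_Ck k U F -> is_Ck k U (fun x => cayley (F x)).
Proof.
move=> oU uF Fk; refine (is_Ck_mulmx oU (is_Ck_1B oU Fk) _).
by apply: is_Ck_invmx => //; apply: is_Ck_1D.
Qed.

Let open_unit_domain : open unit_domain.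
Proof.
apply: open_unitmx; apply: is_Ck_1D; first exact: openT.
exact: is_Ck_mx_linear mulXT_linear openT.
Qed.

Let L_Ck k : is_Ck k setT L.
Proof. exact: is_Ck_mx_linear (@subspace_vec_linear _ _ S) openT. Qed.

Let L_unit u : 1%:M + L u \in unitmx.
Proof. exact/skew_unitmx/Sskew/subspace_vec_mem. Qed.

Let cayleyL_Ck k : is_Ck k setT (fun u => cayley (L u)).
Proof. exact: (is_Ck_cayley openT (fun u _ => L_unit u) (@L_Ck k)). Qed.

Let chart_Ck k : is_Ck k setT chart.
Proof.
exact: is_Ck_linear_comp mulX_linear (mx_linear_continuous mulX_linear) openT
  (@cayleyL_Ck k).
Qed.

Let chart_diffeo : exists U : set 'M[R]_n,
  open U /\ diffeo_between setT (M `&` U) chart.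
Proof.
exists unit_domain; split; first exact: open_unit_domain.
pose h Y := subspace_coord S (cayley (Y *m X^T)).
have XXT : X^T *m X = 1%:M by apply: mulmx1C.
exists h; split.
- move=> u _; have LS : L u \in S := subspace_vec_mem u.
  have cX : chart u *m X^T = cayley (L u) by rewrite -mulmxA XX mulmx1.
  split; last by rewrite /h cX cayleyK ?subspace_vecK.
  by split; [exact: SM|rewrite /unit_domain /= cX; apply: cayley_unitmx].
- move=> Y [MY uY]; split => //.
  rewrite /chart /L /h subspace_coordK ?cayleyK //; last exact: MS.
  by rewrite -mulmxA XXT mulmx1.
- move=> u _; exists setT, chart; split=> //; exact: openT.
- move=> Y [MY uY]; exists unit_domain, h; split => //.
  move=> k; apply: (is_Ck_linear_comp (L := @subspace_coord R _ S)).
  + exact: subspace_coord_linear.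
  + exact: mx_linear_continuous (@subspace_coord_linear _ _ S).
  + exact: open_unit_domain.
  + apply: is_Ck_cayley => //.
    exact: is_Ck_mx_linear mulXT_linear open_unit_domain.
Qed.

Let L0 : L 0 = 0.
Proof. by rewrite /L /subspace_vec big1 // => i _; rewrite mxE scale0r. Qed.

Let chart0 : chart 0 = X.
Proof. by rewrite /chart L0 cayley0 mul1mx. Qed.

Let derive_chart0 v : 'D_v chart 0 = - 2 *: (L v *m X).
Proof.
have dL : differentiable L 0 by have [+ _] := @L_Ck 1; apply.
have DL : 'D_v L 0 = L v.
  have lL : linear L by exact: subspace_vec_linear.
  rewrite (derive_linear_comp (f := idfun) _ lL (mx_linear_continuous lL)) //.
  by rewrite derive_id.
have dP : differentiable (fun u => cayley (L u)) 0.
  by have [+ _] := @cayleyL_Ck 1; apply.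
have dc : differentiable (cst 1%:M : _ -> 'M[R]_n) (0 : 'rV[R]_(\dim S)).
  exact: differentiable_cst.
(* differentiate [cayley (L u) (1 + L u) = 1 - L u] *)
have : 'D_v (fun u => cayley (L u) *m (1%:M + L u)) 0 = 'D_v (fun u => 1%:M - L u) 0.
  apply: (@derive_eq_open _ _ _ setT); [exact: openT|by []|].
  by move=> u _; apply: cayleyMr.
have dG : differentiable (fun u => 1%:M + L u) 0 := differentiableD dc dL.
rewrite (derive_mulmx _ dP dG).
rewrite deriveD; [|exact: diff_derivable..].
rewrite (deriveB (f := cst 1%:M)); [|exact: diff_derivable..].
rewrite derive_cst DL L0 cayley0 addr0 mulmx1 mul1mx add0r sub0r => /(canRL (addrK _)) DP.
rewrite (derive_linear_comp _ mulX_linear (mx_linear_continuous mulX_linear) dP).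
by rewrite DP -opprD -mulr2n -scaler_nat scaleNr mulNmx scalemxAl.
Qed.

Lemma cayley_parametrization : exists c : parametrization M X,
  param_dim c = \dim S /\
  forall A, A \in S -> exists u : 'rV_(param_dim c),
    'D_u (param_map c) (param_base c) = A *m X.
Proof.
exists (@Parametrization _ _ _ M X (\dim S) setT chart 0 openT I chart0 chart_diffeo).
(* The factor [- 2^-1] cancels the derivative [-2] of the Cayley transform at 0. *)
split=> // A AS; exists (subspace_coord S (- 2^-1 *: A)) => /=.
rewrite derive_chart0 /L subspace_coordK ?memvZ // scalemxAl scalerA.
by rewrite mulrNN divff ?pnatr_eq0 // scale1r.
Qed.

End cayley_parametrization.

(** * Critical points of a diagonal coordinate on SO(n) *)

Section skew_subspaces.
Context {R : realType} {n : nat}.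
Variable i : 'I_n.
Local Notation e := (delta_mx i (0 : 'I_1) : 'cV[R]_n).

(** As the kernel of [A |-> A + A^T] this is a [vspace], whose [\dim] serves as the dimension of the
    charts. *)
Definition skew_mx : {vspace 'M[R]_n} := lker (linfun (idfun \+ @trmx R n n)).

Definition skew_stab_mx : {vspace 'M[R]_n} := (skew_mx :&: lker (linfun (col i)))%VS.

Lemma mem_skew_mx A : (A \in skew_mx) = (A^T == - A).
Proof. by rewrite memv_ker lfunE /= addrC addr_eq0. Qed.

Lemma mem_skew_stab_mx A :
  (A \in skew_stab_mx) = (A^T == - A) && (A *m e == 0).
Proof. by rewrite memv_cap mem_skew_mx memv_ker lfunE /= colE. Qed.

(** Row [i] has norm 1, all of it carried by the entry [X i i]; the other squares sum to 0. *)
Lemma orthogonal_row (X : 'M[R]_n) : X *m X^T = 1%:M -> X i i ^+ 2 = 1 ->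
  row i X = X i i *: delta_mx 0 i.
Proof.
move=> /matrixP/(_ i i); rewrite !mxE eqxx => XX X2.
have : \sum_(k | k != i) X i k ^+ 2 = 0.
  apply: (addrI (X i i ^+ 2)); rewrite addr0 {2}X2 -[RHS]XX [RHS](bigD1 i) //=.
  by rewrite mxE -expr2; congr (_ + _); apply: eq_bigr => k _; rewrite mxE expr2.
move/eqP; rewrite psumr_eq0 => [/allP X0|k _]; last exact: sqr_ge0.
apply/rowP => k; rewrite !mxE /=; case: eqVneq => [->|ki]; first by rewrite mulr1.
have := X0 k; rewrite mem_index_enum ki sqrf_eq0 => /(_ isT)/eqP ->.
by rewrite mulr0.
Qed.

Lemma orthogonal_col (X : 'M[R]_n) : X *m X^T = 1%:M -> X i i ^+ 2 = 1 ->
  X *m e = X i i *: e.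
Proof.
move=> XX X2; have := @orthogonal_row X^T.
rewrite trmxK mxE => /(_ (mulmx1C XX) X2) rX; apply: trmx_inj.
by rewrite trmx_mul linearZ /= trmx_delta -rowE.
Qed.

Lemma orthogonal_tr_col (X : 'M[R]_n) : X *m X^T = 1%:M -> X i i ^+ 2 = 1 ->
  X^T *m e = X i i *: e.
Proof.
move=> XX X2; rewrite (_ : X i i = X^T i i); last by rewrite mxE.
by apply: orthogonal_col; rewrite ?trmxK ?mxE ?(mulmx1C XX).
Qed.

End skew_subspaces.

Section special_orthogonal_charts.
Context {R : realType} {n : nat}.
Implicit Types X Y v : 'M[R]_n.

Lemma SO_orthogonal X : SO R n X -> X *m X^T = 1%:M.
Proof. by case. Qed.

Lemma SO_cayley X A : SO R n X -> A^T = - A -> SO R n (cayley A *m X).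
Proof.
move=> [XX dX] /cayley_orthogonal [CC dC]; split.
  by rewrite trmx_mul mulmxA -[_ *m X *m _]mulmxA XX mulmx1.
by rewrite det_mulmx dX dC mulr1.
Qed.

Lemma cayley_SO_skew X Y : SO R n X -> SO R n Y -> 1%:M + Y *m X^T \in unitmx ->
  (cayley (Y *m X^T))^T = - cayley (Y *m X^T).
Proof.
move=> [XX _] [YY _]; apply: cayley_skew.
by rewrite trmx_mul trmxK mulmxA -[_ *m X^T *m _]mulmxA (mulmx1C XX) mulmx1.
Qed.

(** A single [c] realizes all the tangent vectors at once, as the Hessian of a pair requires. *)
Lemma SO_parametrization X : SO R n X -> exists c : parametrization (SO R n) X,
  param_dim c = \dim (@skew_mx R n) /\
  forall v, (v *m X^T)^T = - (v *m X^T) ->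
    exists u : 'rV_(param_dim c), 'D_u (param_map c) (param_base c) = v.
Proof.
move=> SX; have [XX _] := SX.
have [A|A|Y SY uY|c [dc cA]] := @cayley_parametrization R n (SO R n) X skew_mx XX.
- by rewrite mem_skew_mx => /eqP.
- by rewrite mem_skew_mx => /eqP; apply: SO_cayley.
- by rewrite mem_skew_mx; apply/eqP/cayley_SO_skew.
exists c; split=> // v vX; have [|u uE] := cA (v *m X^T).
  by rewrite mem_skew_mx; apply/eqP.
by exists u; rewrite uE -mulmxA (mulmx1C XX) mulmx1.
Qed.

Lemma tangent_space_SO X : SO R n X ->
  tangent_space (SO R n) X = [set v | (v *m X^T)^T = - (v *m X^T)].
Proof.
move=> SX; apply/seteqP; split=> v /=.
  exact: (tangent_space_skew SO_orthogonal).
by move=> vX; have [c [_ /(_ v vX) [u <-]]] := SO_parametrization SX; exists c, u.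
Qed.

Lemma SO_smooth_manifold : smooth_manifold (SO R n).
Proof.
exists (\dim (@skew_mx R n)) => X /SO_parametrization [c [dc _]]; by exists c.
Qed.

Lemma hessian_SO X i v w : SO R n X -> X i i ^+ 2 = 1 ->
  tangent_space (SO R n) X v -> tangent_space (SO R n) X w ->
  hessian (SO R n) (fun Y => Y i i) X v w = - X i i * \sum_k v i k * w i k.
Proof.
move=> SX X2; rewrite tangent_space_SO //= => vX wX.
apply: (hessian_diag_coord SO_orthogonal) => //.
  exact: orthogonal_row (SO_orthogonal SX) X2.
have [c [_ cX]] := SO_parametrization SX; have [s <-] := cX v vX.
by have [t <-] := cX w wX; exists c, s, t.
Qed.

Variable i : 'I_n.
Local Notation e := (delta_mx i (0 : 'I_1) : 'cV[R]_n).

Lemma orthogonal_mul_tr_diag X v : X *m X^T = 1%:M -> X i i ^+ 2 = 1 ->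
  (v *m X^T) i i = X i i * v i i.
Proof.
move=> XX X2; have /colP/(_ i) : col i (v *m X^T) = X i i *: col i v.
  by rewrite !colE -mulmxA orthogonal_tr_col // scalemxAr.
by rewrite [col _ _ i 0]mxE => ->; rewrite !mxE.
Qed.

(** The skew matrix [v X^T] has zero diagonal, and its entry at [i] is [X i i * v i i] with [X i i]
    nonzero. *)
Lemma tangent_SO_diag X v : SO R n X -> X i i ^+ 2 = 1 ->
  tangent_space (SO R n) X v -> v i i = 0.
Proof.
move=> SX X2; rewrite tangent_space_SO //=.
move/matrixP/(_ i i); rewrite mxE [RHS]mxE => /eqP.
rewrite -addr_eq0 -mulr2n mulrn_eq0 /= orthogonal_mul_tr_diag //; last by case: SX.
by rewrite mulf_eq0 -[X i i == 0]sqrf_eq0 X2 oner_eq0 => /eqP.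
Qed.

Lemma critical_locus_SO :
  critical_locus (SO R n) (fun Y => Y i i) = [set X | SO R n X /\ X i i ^+ 2 = 1].
Proof.
apply/seteqP; split=> X /= [SX Xcrit]; split=> //; have XX := SO_orthogonal SX.
  have X0 k : k != i -> X k i = 0.
    (* For this [A] the diagonal entry [(A X) i i] is [X k i]. *)
    move=> ki; pose A : 'M[R]_n := delta_mx i k - delta_mx k i.
    have TA : tangent_space (SO R n) X (A *m X).
      rewrite tangent_space_SO //= -mulmxA XX mulmx1 /A.
      by rewrite linearB /= !trmx_delta opprB.
    have := Xcrit _ TA; rewrite mdiff_coord // mxE (bigD1 k) //= big1.
      by rewrite !mxE !eqxx [i == k]eq_sym (negPf ki) subr0 mul1r addr0.
    move=> l lk; rewrite !mxE eqxx [i == k]eq_sym (negPf ki) (negPf lk).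
    by rewrite subr0 mul0r.
  (* Column [i] has norm 1 and only its diagonal entry survives. *)
  have /matrixP/(_ i i) := mulmx1C XX; rewrite !mxE eqxx => XXi.
  apply: etrans XXi; rewrite (bigD1 i) //= big1 ?addr0 ?mxE ?expr2 // => k ki.
  by rewrite X0 // mulr0.
by move=> v Tv; rewrite mdiff_coord //; apply: tangent_SO_diag Tv.
Qed.

End special_orthogonal_charts.

(** * The critical submanifolds *)

Section level_sets.
Context {R : realType} {n : nat}.
Variables (i : 'I_n) (P : set R).
Hypothesis P2 : forall r, P r -> r ^+ 2 = 1.
Implicit Types X Y v : 'M[R]_n.
Local Notation e := (delta_mx i (0 : 'I_1) : 'cV[R]_n).

(* [P] is [{1}], [{-1}] or [{1, -1}]: the two pieces and the whole critical
   locus are handled together. *)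
Definition SO_level : set 'M[R]_n := [set X | SO R n X /\ P (X i i)].

Lemma SO_level_orthogonal X : SO_level X -> X *m X^T = 1%:M.
Proof. by case=> [[]]. Qed.

(** [A e = 0] gives [cayley A e = e]; since [X e] is a multiple of [e], column [i] of [X] is
    unchanged. *)
Lemma SO_level_cayley X A : SO_level X -> A \in skew_stab_mx i ->
  SO_level (cayley A *m X).
Proof.
move=> [SX PX]; rewrite mem_skew_stab_mx => /andP[/eqP skA /eqP Ae].
split; first exact: SO_cayley.
have uA := skew_unitmx skA.
have Ce : cayley A *m e = e.
  apply: (can_inj (mulKmx uA)).
  by rewrite mulmxA cayleyMl // mulmxBl mulmxDl Ae subr0 addr0.
have /colP/(_ i) : col i (cayley A *m X) = col i X.
  rewrite !colE -mulmxA orthogonal_col ?(P2 PX) //; last by case: SX.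
  by rewrite -scalemxAr Ce.
by rewrite mxE => ->; rewrite mxE.
Qed.

Lemma cayley_SO_level X Y : SO_level X -> SO_level Y ->
  1%:M + Y *m X^T \in unitmx -> cayley (Y *m X^T) \in skew_stab_mx i.
Proof.
move=> [SX /P2 PX] [SY /P2 PY] uQ; set Q := Y *m X^T in uQ *.
rewrite mem_skew_stab_mx; apply/andP; split; first exact/eqP/cayley_SO_skew.
have Qe : Q *m e = (X i i * Y i i) *: e.
  rewrite -mulmxA orthogonal_tr_col //; last by case: SX.
  rewrite -scalemxAr orthogonal_col ?scalerA //; last by case: SY.
have : (X i i * Y i i) ^+ 2 == 1 by rewrite exprMn PX PY mulr1.
(* if the signs of X and Y differ then [Q e = - e], so [1 + Q] is singular: the
   chart at X does not meet the other component *)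
rewrite sqrf_eq1 => /orP[/eqP XY|/eqP XY].
  apply/eqP/(can_inj (mulKmx uQ)); rewrite mulmx0 mulmxA cayleyMl //.
  by rewrite mulmxBl mul1mx Qe XY scale1r subrr.
have : (1%:M + Q) *m e = 0 by rewrite mulmxDl mul1mx Qe XY scaleN1r subrr.
rewrite -[RHS](mulmx0 _ (1%:M + Q)) => /(can_inj (mulKmx uQ)).
by move=> /colP/(_ i); rewrite !mxE !eqxx => /eqP; rewrite oner_eq0.
Qed.

Lemma SO_level_parametrization X : SO_level X -> exists c : parametrization SO_level X,
  param_dim c = \dim (@skew_stab_mx R n i) /\
  forall A, A \in skew_stab_mx i -> exists u : 'rV_(param_dim c),
    'D_u (param_map c) (param_base c) = A *m X.
Proof.
move=> SX; apply: cayley_parametrization.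
- exact: SO_level_orthogonal.
- by move=> A; rewrite mem_skew_stab_mx => /andP[/eqP].
- by move=> A; apply: SO_level_cayley.
- by move=> Y; apply: cayley_SO_level.
Qed.

Lemma SO_level_smooth_manifold : smooth_manifold SO_level.
Proof.
by exists (\dim (@skew_stab_mx R n i)) => X /SO_level_parametrization[c [dc _]]; exists c.
Qed.

(** Along a parametrization of the level set the off-diagonal entries of row [i] stay 0. The
    diagonal entry is handled by [tangent_SO_diag], since [P] may contain both signs. Conversely,
    [row i v = 0] and skewness give [v X^T e = 0], so [v] comes from the Cayley chart. *)
Lemma tangent_space_SO_level X : SO_level X ->
  tangent_space SO_level X = [set v | tangent_space (SO R n) X v /\ row i v = 0].
Proof.
move=> SX; have [SOX PX] := SX; have XX := SO_level_orthogonal SX.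
rewrite tangent_space_SO //; apply/seteqP; split=> v /=.
  move=> Tv; split; first exact: (tangent_space_skew SO_level_orthogonal) Tv.
  have : tangent_space (SO R n) X v.
    by rewrite tangent_space_SO //=; apply: (tangent_space_skew SO_level_orthogonal) Tv.
  move=> /(tangent_SO_diag SOX (P2 PX)) vii.
  have [c [u vE]] := Tv; have [N [oN Nb NM Nk]] := parametrization_Ck c.
  apply/rowP => k; rewrite !mxE; have [->//|ki] := eqVneq k i.
  rewrite vE -derive_coord; last by have [+ _] := Nk 1; apply.
  rewrite (derive_eq_open (U := N) (g := cst 0)) //; first exact: derive_cst.
  move=> y /NM My; have [_ /P2 Py] := My.
  have /rowP/(_ k) := orthogonal_row (SO_level_orthogonal My) Py.
  by rewrite !mxE (negPf ki) andbF mulr0.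
move=> [vX vi]; have [c [_ cA]] := SO_level_parametrization SX.
have [|u uE] := cA (v *m X^T).
  rewrite mem_skew_stab_mx vX eqxx /=; apply/eqP; apply: oppr_inj.
  rewrite oppr0 -mulNmx -vX -[e]trmxK -trmx_mul trmx_delta.
  by rewrite mulmxA -rowE vi mul0mx trmx0.
by exists c, u; rewrite uE -mulmxA (mulmx1C XX) mulmx1.
Qed.

Lemma row_sqr_eq0 v : \sum_k v i k * v i k = 0 -> row i v = 0.
Proof.
move=> v0; apply: mulmx_tr_eq0; apply/matrixP => a b; rewrite !ord1 !mxE -[RHS]v0.
by apply: eq_bigr => k _; rewrite !mxE.
Qed.

(** Pairing a kernel vector with itself gives, up to sign, the squared norm of its row [i]. *)
Lemma hessian_kernel_SO_level X : SO_level X ->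
  hessian_kernel (SO R n) (fun Y => Y i i) X = tangent_space SO_level X.
Proof.
move=> SX; have [SOX /P2 PX] := SX; rewrite tangent_space_SO_level //.
apply/seteqP; split=> v /= [Tv vH]; split=> //.
  have := vH _ Tv; rewrite hessian_SO // => /eqP.
  rewrite mulf_eq0 oppr_eq0 -[X i i == 0]sqrf_eq0 PX oner_eq0 /= => /eqP.
  exact: row_sqr_eq0.
move=> w Tw; rewrite hessian_SO // big1 ?mulr0 // => k _.
by move/rowP: vH => /(_ k); rewrite !mxE => ->; rewrite mul0r.
Qed.

End level_sets.

(** * The critical submanifolds as copies of SO(n-1) *)

Section coordinate_embedding.
Context {R : realType} {n : nat}.
Variable i : 'I_n.
Local Notation e := (delta_mx i (0 : 'I_1) : 'cV[R]_n).

(* The isometric embedding of R^(n-1) as the orthogonal complement of [e]. *)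
Definition embed_mx : 'M[R]_(n, n.-1) := \matrix_(a, b) (a == lift i b)%:R.
Local Notation J := embed_mx.

Lemma col'_embed m (A : 'M[R]_(m, n)) : A *m J = col' i A.
Proof.
apply/matrixP => a b; rewrite !mxE (bigD1 (lift i b)) //= mxE eqxx mulr1.
by rewrite big1 ?addr0 // => k /negPf kb; rewrite mxE kb mulr0.
Qed.

Lemma row'_embed m (A : 'M[R]_(n, m)) : J^T *m A = row' i A.
Proof. by apply: trmx_inj; rewrite trmx_mul trmxK col'_embed tr_row'. Qed.

Lemma embed_mxK : J^T *m J = 1%:M.
Proof.
by apply/matrixP => a b; rewrite row'_embed !mxE (inj_eq (@lift_inj _ i)).
Qed.

Lemma delta_embed : e^T *m J = 0.
Proof.
apply/matrixP => a b; rewrite col'_embed trmx_delta !mxE.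
by rewrite [lift i b == i]eq_sym (negPf (neq_lift i b)) andbF.
Qed.

Lemma embed_delta : J^T *m e = 0.
Proof. by rewrite -[e]trmxK -trmx_mul delta_embed trmx0. Qed.

Lemma delta_delta : e^T *m e = 1%:M.
Proof.
by rewrite trmx_delta mul_delta_mx; apply/matrixP => a b; rewrite !ord1 !mxE.
Qed.

Lemma embed_complete : J *m J^T + e *m e^T = 1%:M.
Proof.
rewrite trmx_delta mul_delta_mx; apply/matrixP => a b; rewrite !mxE.
case: (unliftP i a) => [a'|] ->.
  rewrite (bigD1 a') //= !mxE eqxx mul1r big1 ?addr0 => [|k ka]; last first.
    by rewrite mxE (inj_eq (@lift_inj _ i)) [a' == k]eq_sym (negPf ka) mul0r.
  by rewrite [lift i a' == i]eq_sym (negPf (neq_lift i a')) addr0 eq_sym.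
rewrite big1 ?eqxx ?add0r => [|k _]; first by rewrite eq_sym.
by rewrite !mxE (negPf (neq_lift i k)) mul0r.
Qed.

(** Laplace expansion along row [i]: one term survives, its sign is [(-1)^(i+i) = 1], and its minor
    is the block [J^T Z J]. *)
Lemma det_embed (Z : 'M[R]_n) eps : row i Z = eps *: delta_mx 0 i ->
  \det Z = eps * \det (J^T *m Z *m J).
Proof.
move=> rZ; have Zi k : Z i k = eps * (k == i)%:R.
  by move/rowP: rZ => /(_ k); rewrite !mxE.
rewrite (expand_det_row Z i) (bigD1 i) //= big1 ?addr0 => [|k ki]; last first.
  by rewrite Zi (negPf ki) mulr0 mul0r.
rewrite Zi eqxx mulr1 /cofactor -signr_odd oddD addbb expr0 mul1r.
rewrite row'_embed col'_embed; congr (_ * \det _).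
by apply/matrixP => a b; rewrite !mxE.
Qed.

End coordinate_embedding.

Section level_set_diffeomorphism.
Context {R : realType} {n : nat}.
Variables (i : 'I_n) (eps : R).
Hypothesis eps2 : eps ^+ 2 = 1.
Local Notation e := (delta_mx i (0 : 'I_1) : 'cV[R]_n).
Local Notation J := (@embed_mx R n i).

(** The witness is the diagonal matrix with entries [eps, 1, ..., 1]. *)
Lemma orthogonal_det_sign k : (0 < k)%N ->
  exists D : 'M[R]_k, D *m D^T = 1%:M /\ \det D = eps.
Proof.
case: k => // k _; pose d : 'rV[R]_k.+1 := \row_j (if j == 0 then eps else 1).
exists (diag_mx d); split.
  rewrite tr_diag_mx mulmx_diag; apply/matrixP => a b; rewrite !mxE.
  by case: (a == 0); rewrite ?mulr1 -?expr2 ?eps2.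
rewrite det_diag big_ord_recl mxE eqxx big1 ?mulr1 // => j _.
by rewrite mxE.
Qed.

(** Row and column [i] of [X] are [eps] times the basis vector, so [X] is determined by its
    complementary block. Extracting and reinserting the block are restrictions of affine maps, hence
    smooth. *)
Lemma SO_level_diffeomorphic : (0 < n.-1)%N ->
  diffeomorphic [set X | SO R n X /\ X i i = eps] (SO R n.-1).
Proof.
move=> n0; have [D [DD dD]] := orthogonal_det_sign n0.
(* [D] corrects the determinant: the block [J^T X J] has determinant [eps] *)
pose g (X : 'M[R]_n) : 'M[R]_n.-1 := D *m J^T *m X *m J.
pose h0 (A : 'M[R]_n.-1) : 'M[R]_n := J *m D^T *m A *m J^T.
pose E : 'M[R]_n := eps *: (e *m e^T).
pose h A := h0 A + E.
have lg : linear g by move=> a A B; rewrite /g mulmxDr mulmxDl -scalemxAr -scalemxAl.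
have lh0 : linear h0 by move=> a A B; rewrite /h0 mulmxDr mulmxDl -scalemxAr -scalemxAl.
have JE : J^T *m E = 0 by rewrite -scalemxAr mulmxA embed_delta mul0mx scaler0.
have EJ : E *m J = 0 by rewrite -scalemxAl -mulmxA delta_embed mulmx0 scaler0.
have hJ A : J^T *m h A *m J = D^T *m A.
  by rewrite /h mulmxDr JE addr0 /h0 !mulmxA embed_mxK mul1mx -mulmxA embed_mxK mulmx1.
have DTD : D^T *m D = 1%:M := mulmx1C DD.
exists g, h; split.
- move=> X [[XX dX] Xi]; have Xi2 : X i i ^+ 2 = 1 by rewrite Xi.
  have rX := orthogonal_row XX Xi2; rewrite Xi in rX.
  have Xe := orthogonal_col XX Xi2; rewrite Xi in Xe.
  have eX : e^T *m X = eps *: e^T by rewrite trmx_delta -rowE.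
  have JXe : J^T *m X *m e = 0 by rewrite -mulmxA Xe -scalemxAr embed_delta scaler0.
  split; first split.
  + rewrite /g !trmx_mul trmxK.
    have -> : D *m J^T *m X *m J *m (J^T *m (X^T *m (J *m D^T))) =
        D *m (J^T *m X *m (J *m J^T) *m X^T *m J) *m D^T by rewrite !mulmxA.
    (* The correction [e e^T] disappears because [J^T X e = 0]. *)
    have -> : J *m J^T = 1%:M - e *m e^T.
      by rewrite -(embed_complete i) addrK.
    rewrite mulmxBr mulmx1 [J^T *m X *m (_ *m _)]mulmxA JXe mul0mx subr0.
    rewrite -[J^T *m X *m _]mulmxA XX.
    by rewrite mulmx1 embed_mxK mulmx1.
  + rewrite /g -!mulmxA det_mulmx dD mulmxA -(det_embed rX) dX.
    by [].
  + rewrite /h /h0 /g.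
    have -> : J *m D^T *m (D *m J^T *m X *m J) *m J^T =
        J *m (D^T *m D) *m J^T *m X *m (J *m J^T) by rewrite !mulmxA.
    rewrite DTD mulmx1.
    have -> : J *m J^T = 1%:M - e *m e^T.
      by rewrite -(embed_complete i) addrK.
    rewrite mulmxBl mul1mx -[_ *m X]mulmxA eX -scalemxAr mulmxBr mulmx1.
    rewrite mulmxBl -scalemxAl -[e *m e^T *m _]mulmxA [e^T *m _]mulmxA delta_delta.
    by rewrite mul1mx mulmxA Xe -scalemxAl subrr subr0 subrK.
- move=> A [AA dA]; have hi : row i (h A) = eps *: delta_mx 0 i.
    rewrite rowE -trmx_delta /h mulmxDr /h0 !mulmxA delta_embed !mul0mx add0r.
    by rewrite -scalemxAr mulmxA delta_delta mul1mx.
  split; last by rewrite /g -!mulmxA [J^T *m _]mulmxA hJ mulmxA DD mul1mx.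
  split; last by move/rowP: hi => /(_ i); rewrite !mxE !eqxx mulr1.
  split; last first.
    (* The determinant is [eps] from the corner times [eps] from [D^T]. *)
    by rewrite (det_embed hi) hJ det_mulmx det_tr dD dA mulr1 -expr2.
  have hT : (h A)^T = J *m A^T *m D *m J^T + E.
    by rewrite /h /h0 /E linearD linearZ /= !trmx_mul !trmxK !mulmxA.
  rewrite hT mulmxDr {1}/h mulmxDl.
  have -> : E *m (J *m A^T *m D *m J^T) = 0 by rewrite !mulmxA EJ !mul0mx.
  have -> : h A *m E = E *m E by rewrite /h mulmxDl /h0 -!mulmxA JE !mulmx0 add0r.
  have -> : h0 A *m (J *m A^T *m D *m J^T) =
      J *m (D^T *m (A *m (J^T *m J) *m A^T) *m D) *m J^T by rewrite !mulmxA.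
  rewrite embed_mxK mulmx1 AA mulmx1 DTD mulmx1 addr0.
  rewrite -scalemxAl -scalemxAr scalerA -expr2 eps2 scale1r.
  by rewrite -mulmxA [e^T *m _]mulmxA delta_delta mul1mx embed_complete.
- move=> X _; exists setT, g; split=> //; first exact: openT.
  by move=> k; apply: is_Ck_mx_linear lg openT.
- move=> A _; exists setT, h; split=> //; first exact: openT.
  move=> k; apply: is_CkD; first exact: openT.
    exact: is_Ck_mx_linear lh0 openT.
  exact: is_Ck_cst.
Qed.

End level_set_diffeomorphism.

(** * The index of the Hessian *)

Section hessian_index.
Context {R : realType} {n : nat}.
Variables (i : 'I_n) (X : 'M[R]_n).
Hypothesis SX : SO R n X.
Local Notation e := (delta_mx i (0 : 'I_1) : 'cV[R]_n).
Local Notation J := (@embed_mx R n i).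
Local Notation f := (fun Y : 'M[R]_n => Y i i).

Lemma hessian_index_min : X i i = -1 -> hessian_has_index (SO R n) f X 0.
Proof.
move=> Xi; have X2 : X i i ^+ 2 = 1 by rewrite Xi sqrrN expr1n.
split.
  exists 0%VS; split; last exact: dimv0.
  split=> v; rewrite memv0 => /eqP->; last by rewrite eqxx.
  by rewrite tangent_space_SO //= mul0mx trmx0 oppr0.
(* A nonzero vector of [V] would have negative Hessian, which is here a sum of squares. *)
move=> V [VT Vneg]; rewrite leqn0 dimv_eq0; apply/negPn/negP => V0.
have [VV Vn0] : vpick V \in V /\ vpick V != 0 by rewrite memv_pick vpick0.
have := Vneg _ VV Vn0; rewrite (hessian_SO SX X2 (VT _ VV) (VT _ VV)) Xi opprK mul1r ltNge.
move=> /negP; apply.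
by apply: sumr_ge0 => k _; rewrite -expr2 sqr_ge0.
Qed.

Lemma hessian_index_max : X i i = 1 -> hessian_has_index (SO R n) f X n.-1.
Proof.
move=> Xi; have X2 : X i i ^+ 2 = 1 by rewrite Xi expr1n.
have XX := SO_orthogonal SX.
split; last first.
  move=> V [VT Vneg].
  (* [g] takes row [i] and deletes its entry [i]. It is injective on [V]: that entry is 0 on tangent
     vectors, and a vector with zero row [i] has zero Hessian. *)
  pose g := linfun (mulmxr J \o mulmx e^T) : 'Hom('M[R]_n, 'rV[R]_n.-1).
  have gE v : g v = e^T *m v *m J by rewrite lfunE.
  have kerg : (V :&: lker g)%VS = 0%VS.
    apply/eqP; rewrite -subv0; apply/subvP => v.
    rewrite memv_cap memv_ker gE memv0 => /andP[Vv /eqP gv].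
    apply/negPn/negP => v0; have := Vneg _ Vv v0.
    rewrite (hessian_SO SX X2 (VT _ Vv) (VT _ Vv)).
    suff rv : row i v = 0.
      rewrite big1 ?mulr0 ?ltxx // => k _.
      by move/rowP: rv => /(_ k); rewrite !mxE => ->; rewrite mul0r.
    rewrite rowE -trmx_delta -[LHS]mulmx1 -(embed_complete i) mulmxDr.
    rewrite mulmxA gv mul0mx add0r mulmxA trmx_delta -rowE -colE.
    apply/rowP => k; rewrite mxE big_ord1 !mxE.
    by rewrite (tangent_SO_diag SX X2 (VT _ Vv)) mul0r.
  rewrite -(limg_dim_eq kerg) (leq_trans (dimvS (subvf _))) //.
  by rewrite dimvf /dim /= mul1n.
(* [h u] is [A X] with [A] the skew matrix whose row [i] is [u J^T]; its own row [i] is then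
   [u J^T X], from which [u] is recovered. *)
pose h : 'Hom('rV[R]_n.-1, 'M[R]_n) :=
  linfun (mulmxr X \o (idfun \- @trmx R n n) \o mulmx e \o mulmxr J^T).
have hE u : h u = (e *m (u *m J^T) - (e *m (u *m J^T))^T) *m X by rewrite lfunE.
have rowh u : row i (h u) = u *m J^T *m X.
  rewrite rowE -trmx_delta hE mulmxA mulmxBr mulmxA delta_delta mul1mx.
  rewrite !trmx_mul trmxK !mulmxA delta_embed !mul0mx subr0.
  by [].
have rowhK u : row i (h u) *m (X^T *m J) = u.
  by rewrite rowh mulmxA -[_ *m X *m X^T]mulmxA XX mulmx1 -mulmxA embed_mxK mulmx1.
have h_inj : injective h by move=> u v huv; rewrite -[u]rowhK huv rowhK.
have hT u : tangent_space (SO R n) X (h u).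
  rewrite tangent_space_SO //= hE -mulmxA XX mulmx1.
  by rewrite linearB /= trmxK opprB.
exists (limg h); split; last first.
  have /eqP kh : lker h == 0%VS by apply/lker0P.
  by rewrite limg_dim_eq ?kh ?capv0 // dimvf /dim /= mul1n.
split=> [v /memv_imgP[u _ ->] //|v /memv_imgP[u _ ->]] hu0.
rewrite (hessian_SO SX X2 (hT u) (hT u)) Xi mulN1r oppr_lt0 lt0r.
rewrite sumr_ge0 ?andbT => [|k _]; last first.
  by rewrite -expr2 sqr_ge0.
apply: contra hu0 => /eqP /row_sqr_eq0; rewrite rowh => hu.
by rewrite -[u]rowhK rowh hu mul0mx linear0.
Qed.

End hessian_index.

(** * The Morse-Bott property *)

Section morse_bott.
Context {R : realType} {n : nat}.
Variable i : 'I_n.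
Local Notation f := (fun Y : 'M[R]_n => Y i i).

Lemma critical_locus_SO_level :
  critical_locus (SO R n) f = SO_level i [set r | r ^+ 2 = 1].
Proof. exact: critical_locus_SO. Qed.

Lemma SO_level_sign_submanifolds :
  disjoint_union_of_submanifolds (SO_level i [set r : R | r ^+ 2 = 1]).
Proof.
pose s (b : bool) : R := if b then 1 else -1.
have s2 b r : r = s b -> r ^+ 2 = 1 by case: b => ->; rewrite ?sqrrN expr1n.
exists bool, (fun b => SO_level i [set s b]); split.
- apply/seteqP; split => [X [SX /eqP]|X [b _ [SX Xb]]]; last first.
    by split=> //=; apply: s2 Xb.
  rewrite sqrf_eq1 => /orP[/eqP X1|/eqP X1]; [exists true => //|exists false => //];
    by split.
- apply/trivIsetP => b c _ _ bc; apply/seteqP; split => // X [[_ /= Xb] [_ /= Xc]].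
  move: Xb; rewrite Xc; case: b c {Xc} bc => -[] //= _ /eqP.
    by rewrite eqNr oner_eq0.
  by rewrite eq_sym eqNr oner_eq0.
(* An open half-space isolates each piece, as [X i i] has opposite signs on the two. *)
- move=> b; exists [set X : 'M[R]_n | 0 < s b * X i i]; split.
    rewrite (_ : [set _ | _] = (fun X : 'M[R]_n => s b * X i i) @^-1` [set r | 0 < r]) //.
    apply: open_comp; last exact: open_gt.
    move=> X _; apply: mx_linear_continuous => a A B.
    by rewrite !mxE mulrDr mulrCA.
  apply/seteqP; split=> [X [SX Xb]|X [[SX /= /eqP X2] Xb]].
    split; first by split=> //=; apply: s2 Xb.
    by rewrite /= Xb -expr2 (s2 b) // ltr01.
  split=> //=; move: X2 Xb; rewrite sqrf_eq1 /s => /orP[] /eqP ->;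
    by case: b => //=; rewrite ?mulrN1 ?mulN1r ?oppr_gt0 ?ltr10 // ltr0N1.
- by move=> b; apply: SO_level_smooth_manifold => r; apply: s2.
Qed.

Lemma SO_coord_Morse_Bott : Morse_Bott (SO R n) f.
Proof.
have lf : linear f by exact: coord_linear.
split; first exact: SO_smooth_manifold.
- move=> X _; exists setT, f; split=> //; first exact: openT.
  by move=> k; apply: is_Ck_mx_linear lf openT.
- by rewrite critical_locus_SO_level; apply: SO_level_sign_submanifolds.
- move=> X; rewrite critical_locus_SO_level => SX.
  exact: hessian_kernel_SO_level SX.
Qed.

End morse_bott.

Theorem mainTheorem5 (R : realType) (n : nat) (n_gt1 : (1 < n)%N) :
  let f : 'M[R]_n -> R := corner n_gt1 in
  let F_bot : set 'M[R]_n := [set X | SO R n X /\ f X = -1] in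
  let F_top : set 'M[R]_n := [set X | SO R n X /\ f X = 1] in
  [/\ Morse_Bott (SO R n) f,
      critical_locus (SO R n) f = F_bot `|` F_top /\ F_bot `&` F_top = set0,
      diffeomorphic F_bot (SO R n.-1) /\ diffeomorphic F_top (SO R n.-1),
      forall X, F_bot X -> hessian_has_index (SO R n) f X 0
    & forall X, F_top X -> hessian_has_index (SO R n) f X n.-1].
Proof.
move=> f F_bot F_top; pose i := last_ord n_gt1.
(* A positive block size leaves room for the determinant-correcting matrix. *)
have n0 : (0 < n.-1)%N by rewrite -subn1 subn_gt0.
split.
- exact: SO_coord_Morse_Bott.
- split.
    rewrite /f /corner critical_locus_SO; apply/seteqP; split=> X /=.
      case=> SX /eqP; rewrite sqrf_eq1 => /orP[] /eqP Xi; [right|left]; by split.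
    by case=> -[SX Xi]; split=> //; rewrite (_ : X _ _ = f X) // Xi ?sqrrN expr1n.
  apply/seteqP; split => // X [[_ Xb] [_ /eqP]] /=.
  by rewrite Xb eqNr oner_eq0.
- by split; apply: SO_level_diffeomorphic => //; rewrite ?sqrrN expr1n.
- by move=> X [SX Xi]; apply: hessian_index_min.
- by move=> X [SX Xi]; apply: hessian_index_max.
Qed.
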